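(* Let $A>0$ and let $\mu=e^{W}\,dx$ be a one-dimensional measure with even convex potential $W$. Assume that $$W''e^{-2W}\ge A^2$$ and $W(0)=0$. Then $\mu$ is the image of the measure $$\nu_A=\frac{dx}{\cos Ax},\qquad -\frac{\pi}{2A}<x<\frac{\pi}{2A},$$ under a $1$-Lipschitz increasing mapping.
   Context: The potential $W$ is defined on an open interval of the real line symmetric about the origin (possibly bounded, as for $\nu_A$), and $\mu$ is the measure with density $e^{W}$ on this interval. The image of a measure $\nu$ under a map $S$ is the pushforward measure $\nu\circ S^{-1}$.
   Formalization: As ν_A has infinite mass, the claim fails when μ is finite; the full image statement with a strictly increasing map is proved when μ has infinite mass, and in general only a nondecreasing 1-Lipschitz map with equality of measures on Borel subsets of the interval of W. *)

(* Defs.v *)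
From HB Require Import structures.
From mathcomp Require Export all_boot all_order all_algebra.
From mathcomp Require Export all_classical all_reals all_analysis.
Export Order.TTheory GRing.Theory Num.Theory.
Export numFieldNormedType.Exports.

Set Implicit Arguments.
Unset Strict Implicit.
Unset Printing Implicit Defensive.

Local Open Scope classical_set_scope.
Local Open Scope ring_scope.

(* The Borel measure [f dx] carried by [D], as a function of Borel subsets of
   the whole line; the values of [f] outside [D] are irrelevant. *)
Definition density_measure (R : realType) (D : set R) (f : R -> R) :
    set (measurableTypeR R) -> \bar R :=
  fun B => (\int[lebesgue_measure]_(x in D `&` B) (f x)%:E)%E.

Definition nu_itv (R : realType) (A : R) : set R :=
  `](- (pi / (2 * A))), (pi / (2 * A))[%classic.

Definition nu_measure (R : realType) (A : R) :
    set (measurableTypeR R) -> \bar R :=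
  density_measure (nu_itv A) (fun x => (cos (A * x))^-1).

Definition twice_derivable_on (R : realType) (I : set R) (W : R -> R) : Prop :=
  forall x, I x -> derivable W x 1 /\ derivable (W^`())%classic x 1.

(* [mu] is carried by [I], [nu] is an image measure on the whole line.  The
   source measure dx / cos (A x) has infinite mass, but [mu] may be finite:
   A = 1 and W x = - ln (1 - x ^+ 2) / 2 on ]-1, 1[ give mass pi.  The increasing
   map then sends the ends of ]-pi / (2 A), pi / (2 A)[ to the endpoints of [I],
   which are not in [I], so the two measures agree on [I] only.  Equality on all
   Borel subsets of the line ([I := setT]) preserves the total mass, hence
   requires mu to be infinite. *)
Definition image_on (R : realType) (I : set R)
    (mu nu : set (measurableTypeR R) -> \bar R) : Prop :=
  forall B : set (measurableTypeR R),
    measurable B -> B `<=` I -> mu B = nu B.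

(* Main.v *)
From HB Require Import structures.
Require Import Defs.
From mathcomp Require Import measurable_realfun ring lra.

(** Let [F] be the odd antiderivative of [expR \o W] on [I], and write
    q = e^W as a function of the new variable s = F(x).  Then dq/ds = W' and
    d^2q/ds^2 = W'' e^{-W} >= A^2 q, so q, which starts at s = 0 with value 1
    and slope 0, dominates the solution of the corresponding equation:
    e^W >= cosh (A F) on [I] ([cosh_le_expW]).

    The primitive of 1 / cos (A y) vanishing at 0 is the inverse of
    s |-> gd (A s) / A, with gd the Gudermannian function atan o sinh.  The
    increasing map that turns [mu] into the restriction of [nu_measure A] to an
    interval around 0 is therefore S(x) = gd (A F(x)) / A ([expanding_map]).
    Since cos (gd u) = 1 / cosh u, its derivative is e^W / cosh (A F), which is
    at least 1 by the comparison: S increases distances.  As it takes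
    its values in the bounded interval [nu_itv A], this also forces [I] to be
    bounded.

    The required map T is the inverse of S.  The image S(I) may be a proper
    subinterval of [nu_itv A]; so T is the generalized inverse [geninv], a
    supremum, which is constant on each side of S(I), with an endpoint of [I]
    as value; it is monotone, and 1-Lipschitz because S increases distances.
    The preimage under T of a segment with ends c, d in [I] is the segment with
    ends S(c), S(d), so integration by substitution shows that [mu] and the
    image of [nu_measure A] agree on such segments, hence on all Borel subsets
    of [I] ([geninv_image_on]).

    If [mu] has infinite mass, then S is onto [nu_itv A]: S being odd, an
    omitted value y would confine S(I) to the points of modulus at most |y|, a
    compact part of [nu_itv A] on which 1 / cos (A y) has a finite integral
    ([odd_omitted_value_bound]).  The endpoints of [I] are then never taken
    by T, and the remaining assertions follow. *)

Set Implicit Arguments.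
Unset Strict Implicit.
Unset Printing Implicit Defensive.

Local Open Scope classical_set_scope.
Local Open Scope ring_scope.

(** * Calculus on an open interval *)

Section calculus.
Context {R : realType}.
Implicit Types (f df F : R -> R) (I : set R) (x y : R).

Lemma is_derive_continuous f x (df : R) :
  is_derive x 1 f df -> {for x, continuous f}.
Proof. by move=> [fx _]; apply/differentiable_continuous/derivable1_diffP. Qed.

(** Endpoints are asked to lie in [I], where [f] is differentiable; this spares
    the users a separate continuity hypothesis. *)
Lemma MVT_interval I f df x y : is_interval I ->
  (forall z, I z -> is_derive z 1 f (df z)) -> I x -> I y -> x < y ->
  exists c, [/\ I c, x < c, c < y & f y - f x = df c * (y - x)].
Proof.
move=> Iitv fdf Ix Iy xy.
have sub z : x <= z <= y -> I z by exact: Iitv.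
have [||c cxy fE] := @MVT _ f df x y xy.
- by move=> z; rewrite in_itv/= => /andP[xz zy]; apply/fdf/sub; rewrite !ltW.
- by apply: derivable_within_continuous => z; rewrite in_itv/= => /sub/fdf[].
- move: cxy; rewrite in_itv/= => /andP[xc cy].
  by exists c; split => //; apply: sub; rewrite !ltW.
Qed.

Lemma is_derive_ge0_homo I f df : is_interval I ->
  (forall z, I z -> is_derive z 1 f (df z)) -> (forall z, I z -> 0 <= df z) ->
  forall x y, I x -> I y -> x <= y -> f x <= f y.
Proof.
move=> Iitv fdf df0 x y Ix Iy; rewrite le_eqVlt => /predU1P[->//|xy].
have [c [Ic _ _ fE]] := MVT_interval Iitv fdf Ix Iy xy.
by rewrite -subr_ge0 fE mulr_ge0 ?df0// subr_ge0 ltW.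
Qed.

Lemma open_lt I x : open I -> I x -> exists2 y, I y & y < x.
Proof.
move=> oI Ix; have /nbhs_ballP[e/= e0 eI] := open_nbhs_nbhs (conj oI Ix).
exists (x - e / 2); last by lra.
by apply: eI; rewrite /ball/= ger0_norm; lra.
Qed.

Lemma open_gt I x : open I -> I x -> exists2 y, I y & x < y.
Proof.
move=> oI Ix; have /nbhs_ballP[e/= e0 eI] := open_nbhs_nbhs (conj oI Ix).
exists (x + e / 2); last by lra.
by apply: eI; rewrite /ball/= ler0_norm; lra.
Qed.

Lemma continuous_itv_integrable I f x y : is_interval I ->
  (forall z, I z -> {for z, continuous f}) -> I x -> I y ->
  lebesgue_measure.-integrable `[x, y] (EFin \o f).
Proof.
move=> Iitv cf Ix Iy; apply: continuous_compact_integrable.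
  exact: segment_compact.
apply: continuous_in_subspaceT => z; rewrite inE/= in_itv/= => zxy.
by apply: cf; apply: Iitv zxy.
Qed.

(** The fundamental theorem of calculus differentiates integrals from a fixed
    left endpoint, but an open interval does not contain its own and [f] need
    not be integrable up to it.  Hence an oriented integral, based at [x0]. *)
Lemma continuous_antiderivative I f x0 : open I -> is_interval I -> I x0 ->
  (forall x, I x -> {for x, continuous f}) ->
  exists F, forall x, I x -> is_derive x 1 F (f x).
Proof.
move=> oI Iitv Ix0 cf.
pose int x y := \int[lebesgue_measure]_(t in `[x, y]) f t.
have chasles x y z : I x -> I z -> x <= y -> y <= z ->
    int x z = int x y + int y z.
  move=> Ix Iz xy yz; have fxz := continuous_itv_integrable Iitv cf Ix Iz.
  rewrite /int -(@Rintegral_itv_obnd_cbnd _ y).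
    rewrite -(@Rintegral_itvB _ _ (BLeft x) (BRight z) y) ?bnd_simp//.
    by rewrite addrC subrK.
  by apply: integrableS fxz => //; apply: subset_itvr; rewrite bnd_simp.
exists (fun x => int x0 x - int x x0) => x Ix.
(* Near [x], the difference of the two integrals is an integral from a
   fixed base point [c] to the left of [x] and of [x0], up to a constant. *)
have [c [Ic cx cx0]] : exists c, [/\ I c, c < x & c < x0].
  have Im : I (Num.min x x0) by case: (leP x x0).
  have [c Ic] := open_lt oI Im; rewrite lt_min => /andP[? ?].
  by exists c.
have [u Iu xu] := open_gt oI Ix.
have int_c := continuous_itv_integrable Iitv cf Ic Iu.
have [dF F'] := continuous_FTC1_closed xu int_c cx (cf _ Ix).
apply: (@near_eq_is_derive _ _ _ (fun y => int c y - int c x0)).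
  near=> y.
  have cy : c < y by near: y; exact: lt_nbhsr.
  have yu : y < u by near: y; exact: lt_nbhsl.
  have Iy : I y by apply: (Iitv _ _ Ic Iu); rewrite !ltW.
  have int_nil p q : p <= q -> int q p = 0.
    rewrite le_eqVlt /int => /predU1P[->|pq].
      by rewrite set_itv1 Rintegral_set1.
    by rewrite set_itv_ge ?Rintegral_set0// bnd_simp -ltNge.
  have [x0y|yx0] := leP x0 y.
    by rewrite (int_nil x0 y)// (chasles c x0 y)// ?ltW//; ring.
  by rewrite (int_nil y x0) ?ltW// (chasles c y x0)// ?ltW//; ring.
rewrite -[f x]subr0 -F'; apply: is_deriveB.
by rewrite derive1E; exact/derivableP.
Unshelve. all: by end_near. Qed.

End calculus.

(** * Hyperbolic functions and the Gudermannian *)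

Section hyperbolic.
Context {R : realType}.
Implicit Types u : R.

Definition cosh u := (expR u + expR (- u)) / 2.
Definition sinh u := (expR u - expR (- u)) / 2.

Lemma cosh_gt0 u : 0 < cosh u.
Proof. by rewrite divr_gt0// addr_gt0// expR_gt0. Qed.

Lemma cosh_sqr u : cosh u ^+ 2 = 1 + sinh u ^+ 2.
Proof. by rewrite /cosh /sinh expRN; field; rewrite gt_eqF ?expR_gt0. Qed.

Lemma sinhN u : sinh (- u) = - sinh u.
Proof. by rewrite /sinh opprK -mulNr opprB. Qed.

Lemma cosh0 : cosh 0 = 1.
Proof. by rewrite /cosh oppr0 expR0; lra. Qed.

Lemma sinh0 : sinh 0 = 0.
Proof. by rewrite /sinh oppr0 subrr mul0r. Qed.

Lemma is_derive_cosh u : is_derive u 1 cosh (sinh u).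
Proof.
have -> : cosh = 2^-1 \*: (expR + (expR \o -%R)).
  by apply/funext => x; rewrite /cosh mulrC.
by apply: is_derive_eq; rewrite /sinh /GRing.scale/= mulrN1 mulrC.
Qed.

Lemma is_derive_sinh u : is_derive u 1 sinh (cosh u).
Proof.
have -> : sinh = 2^-1 \*: (expR - (expR \o -%R)).
  by apply/funext => x; rewrite /sinh mulrC.
by apply: is_derive_eq; rewrite /cosh /GRing.scale/= mulrN1 opprK mulrC.
Qed.

(** The Gudermannian function. *)
Definition gd u := atan (sinh u).

Lemma gdN u : gd (- u) = - gd u.
Proof. by rewrite /gd sinhN atanN. Qed.

Lemma gd_bound u : - (pi / 2) < gd u < pi / 2.
Proof. by rewrite atan_gtNpi2 atan_ltpi2. Qed.

Lemma cos_gd u : cos (gd u) = (cosh u)^-1.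
Proof. by rewrite cos_atan -cosh_sqr sqrtr_sqr gtr0_norm ?cosh_gt0. Qed.

Lemma is_derive_gd u : is_derive u 1 gd (cosh u)^-1.
Proof.
have -> : (cosh u)^-1 = (1 + sinh u ^+ 2)^-1 * cosh u.
  by rewrite -cosh_sqr -exprVn expr2 divfK// gt_eqF// cosh_gt0.
exact: (is_derive1_comp (is_derive1_atan (sinh u)) (is_derive_sinh u)).
Qed.

End hyperbolic.

(** * The comparison e^W >= cosh (A F) and the expanding map *)

Section comparison.
Context {R : realType}.
Variables (A : R) (I : set R) (W : R -> R).
Hypotheses (A_gt0 : 0 < A) (I_open : open I) (I_itv : is_interval I).
Hypotheses (I0 : I 0) (I_sym : forall x, I x -> I (- x)).
Hypothesis W_even : forall x, I x -> W (- x) = W x.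
Hypothesis W_diff : twice_derivable_on I W.
Hypothesis W_hyp :
  forall x, I x -> A ^+ 2 <= (W^`(2))%classic x * expR (- 2 * W x).
Hypothesis W0 : W 0 = 0.

Let W' : R -> R := (W^`())%classic.
Let W'' : R -> R := (W^`(2))%classic.

Let W_derive x : I x -> is_derive x 1 W (W' x).
Proof. by move=> /W_diff[? _]; rewrite /W' derive1E; exact/derivableP. Qed.

Let W'_derive x : I x -> is_derive x 1 W' (W'' x).
Proof. by move=> /W_diff[_ ?]; rewrite /W'' /= derive1E; exact/derivableP. Qed.

Let expW_derive x : I x -> is_derive x 1 (expR \o W) (expR (W x) * W' x).
Proof.
by move=> Ix; exact: is_derive1_comp (is_derive_expR _) (W_derive Ix).
Qed.

Lemma exp_potential_continuous x : I x -> {for x, continuous (expR \o W)}.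
Proof. by move=> Ix; exact: is_derive_continuous (expW_derive Ix). Qed.

Lemma potential_derive0 : W' 0 = 0.
Proof.
have d1 := W_derive I0.
have d2 : is_derive (0 : R) 1 (W \o -%R) (W' 0 * - 1).
  apply: is_derive1_comp (is_deriveNid _ _).
  by rewrite oppr0.
have d3 : is_derive (0 : R) 1 W (W' 0 * - 1).
  apply: near_eq_is_derive d2.
  by apply: filterS (open_nbhs_nbhs (conj I_open I0)) => y /W_even.
have [_ e1] := d1; have [_ e3] := d3.
by move: e1; rewrite e3; lra.
Qed.

(** Oddness is built in by antisymmetrizing an arbitrary antiderivative; the
    derivative is unchanged because [W] is even. *)
Lemma odd_antiderivative_exp : exists F : R -> R,
  (forall x, F (- x) = - F x) /\
  (forall x, I x -> is_derive x 1 F (expR (W x))).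
Proof.
have [x Ix|G dG] := continuous_antiderivative (f := expR \o W) I_open I_itv I0.
  exact: exp_potential_continuous.
exists (fun x => (G x - G (- x)) / 2); split => [x|x Ix].
  by rewrite opprK -mulNr opprB.
have -> : (fun x => (G x - G (- x)) / 2) = 2^-1 \*: (G - (G \o -%R)).
  by apply/funext => y; rewrite mulrC.
have dGN : is_derive x 1 (G \o -%R) (expR (W (- x)) * - 1).
  exact: is_derive1_comp (dG _ (I_sym Ix)) (is_deriveNid _ _).
have dGx := dG x Ix.
apply: is_derive_eq; rewrite /= W_even// /GRing.scale/=; lra.
Qed.

Section with_antiderivative.
Variable F : R -> R.
Hypothesis F_odd : forall x, F (- x) = - F x.
Hypothesis F_derive : forall x, I x -> is_derive x 1 F (expR (W x)).

Let F0 : F 0 = 0.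
Proof. by have := F_odd 0; rewrite oppr0; lra. Qed.

Let AF_derive x : I x -> is_derive x 1 (A \*: F) (A * expR (W x)).
Proof. by move=> Ix; have dF := F_derive Ix; exact: is_deriveZ. Qed.

Let C x := cosh (A * F x).
Let D x := sinh (A * F x).

Let C_derive x : I x -> is_derive x 1 C (D x * (A * expR (W x))).
Proof.
by move=> Ix; exact: is_derive1_comp (is_derive_cosh _) (AF_derive Ix).
Qed.

Let D_derive x : I x -> is_derive x 1 D (C x * (A * expR (W x))).
Proof.
by move=> Ix; exact: is_derive1_comp (is_derive_sinh _) (AF_derive Ix).
Qed.

(** The Wronskian of q = e^W and of cosh (A s) with respect to s = F(x).  Its
    derivative in x is the defect in W'' >= A^2 e^{2W} multiplied by a positive
    factor, so its sign is that of x. *)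
Let N x : R := W' x * C x - A * expR (W x) * D x.

Let N_derive x : I x ->
  is_derive x 1 N ((W'' x - A ^+ 2 * expR (W x) ^+ 2) * C x).
Proof.
move=> Ix; have dW' := W'_derive Ix; have dC := C_derive Ix.
have dD := D_derive Ix; have dE := expW_derive Ix.
have -> : N = W' * C - (A \*: (expR \o W)) * D by [].
by apply: is_derive_eq; rewrite /GRing.scale/= /GRing.scale/=; ring.
Qed.

Let dN_ge0 x : I x -> 0 <= (W'' x - A ^+ 2 * expR (W x) ^+ 2) * C x.
Proof.
move=> Ix; rewrite mulr_ge0 ?(ltW (cosh_gt0 _))// subr_ge0.
rewrite -ler_pdivlMr ?exprn_gt0 ?expR_gt0//.
have -> : (expR (W x) ^+ 2)^-1 = expR (- 2 * W x).
  by rewrite mulNr expRN expRM_natl.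
exact: W_hyp.
Qed.

Let N0 : N 0 = 0.
Proof. by rewrite /N /D F0 mulr0 sinh0 potential_derive0; ring. Qed.

Let N_ge0 x : I x -> 0 <= x -> 0 <= N x.
Proof.
by move=> Ix x0; rewrite -N0; exact: (is_derive_ge0_homo I_itv N_derive).
Qed.

Let N_le0 x : I x -> x <= 0 -> N x <= 0.
Proof.
by move=> Ix x0; rewrite -N0; exact: (is_derive_ge0_homo I_itv N_derive).
Qed.


Let Q x := expR (W x) / C x.

Let dQ x := expR (W x) * N x / C x ^+ 2.

Let Q_derive x : I x -> is_derive x 1 Q (dQ x).
Proof.
move=> Ix; have C0 : C x != 0 by rewrite gt_eqF// cosh_gt0.
have dC := is_deriveV C0 (C_derive Ix).
have dE := expW_derive Ix.
have -> : Q = (expR \o W) * (fun y => (C y)^-1) by [].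
by apply: is_derive_eq; rewrite /dQ /N /GRing.scale/=; field.
Qed.

(** The quotient e^W / cosh (A F) equals 1 at 0 and its derivative has the sign
    of the Wronskian, that is of x: 0 is a global minimum. *)
Lemma cosh_le_expW x : I x -> cosh (A * F x) <= expR (W x).
Proof.
move=> Ix; suff : 1 <= Q x by rewrite /Q ler_pdivlMr ?cosh_gt0// mul1r.
have Q0 : Q 0 = 1 by rewrite /Q W0 /C F0 mulr0 cosh0 expR0 divr1.
have [x0|/ltW x0] := leP 0 x.
  have Px : is_interval (I `&` [set y | 0 <= y]).
    move=> p q [Ip p0] [Iq _] r prq; split; first exact: I_itv prq.
    by case/andP: prq => + _; exact: le_trans.
  rewrite -Q0; apply: (is_derive_ge0_homo (df := dQ) Px) => //.
  - by move=> z [Iz _]; exact: Q_derive.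
  - move=> z [Iz z0]; rewrite divr_ge0 ?sqr_ge0// mulr_ge0 ?expR_ge0//.
    exact: N_ge0.
  - by split => /=.
have Px : is_interval (I `&` [set y | y <= 0]).
  move=> p q [Ip _] [Iq q0] r prq; split; first exact: I_itv prq.
  by case/andP: prq => _ rq; exact: le_trans rq q0.
rewrite -Q0 -lerN2; apply: (is_derive_ge0_homo (f := - Q) (df := - dQ) Px) =>
  //.
- by move=> z [Iz _]; have dQz := Q_derive Iz; exact: is_deriveN.
- move=> z [Iz z0]; rewrite -mulNr -mulrN mulr_ge0 ?invr_ge0 ?sqr_ge0//.
  by rewrite mulr_ge0 ?expR_ge0// oppr_ge0 N_le0.
- by split => /=.
Qed.


(** The monotone rearrangement of e^W dx into dx / cos (A x), obtained by
    equating the mass of the former between 0 and x with the mass of the latter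
    between 0 and the image of x. *)
Definition expanding_map x := gd (A * F x) / A.

Lemma expanding_map_odd x : expanding_map (- x) = - expanding_map x.
Proof. by rewrite /expanding_map F_odd mulrN gdN mulNr. Qed.

Lemma expanding_map_bound x : nu_itv A (expanding_map x).
Proof.
rewrite /nu_itv/= in_itv/=; have /andP[lo hi] := gd_bound (A * F x).
rewrite /expanding_map invfM mulrA -mulNr ltr_pM2r ?invr_gt0// lo/=.
by rewrite ltr_pM2r ?invr_gt0.
Qed.

Lemma cos_expanding_map x : cos (A * expanding_map x) = (cosh (A * F x))^-1.
Proof. by rewrite /expanding_map mulrC divfK ?gt_eqF// cos_gd. Qed.

Lemma expanding_map_derive x : I x ->
  is_derive x 1 expanding_map (expR (W x) / cosh (A * F x)).
Proof.
move=> Ix; have -> : expanding_map = A^-1 \*: (gd \o (A \*: F)).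
  by apply/funext => y; rewrite /expanding_map mulrC.
have dF := AF_derive Ix.
have := is_derive1_comp (is_derive_gd ((A \*: F) x)) dF => dG.
apply: is_derive_eq; rewrite /GRing.scale/=; field.
by rewrite !gt_eqF// cosh_gt0.
Qed.

Lemma expanding_map_derive_continuous x : I x ->
  {for x, continuous (fun y => expR (W y) / cosh (A * F y))}.
Proof.
move=> Ix; apply: cvgM; first exact: exp_potential_continuous.
apply: cvgV; first by rewrite gt_eqF// cosh_gt0.
exact: is_derive_continuous (C_derive Ix).
Qed.

Lemma expanding_map_expansive x y : I x -> I y -> x <= y ->
  y - x <= expanding_map y - expanding_map x.
Proof.
move=> Ix Iy; rewrite le_eqVlt => /predU1P[->|xy]; first by rewrite !subrr.
have [c [Ic _ _ ->]] := MVT_interval I_itv expanding_map_derive Ix Iy xy.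
apply: ler_peMl; first by rewrite subr_ge0 ltW.
by rewrite ler_pdivlMr ?cosh_gt0// mul1r; exact: cosh_le_expW.
Qed.

End with_antiderivative.

End comparison.

(** * Generalized inverse of an expanding map *)

Section generalized_inverse.
Context {R : realType}.
Variables (a b : R) (S : R -> R).
Hypothesis ab : a <= b.
Hypothesis S_expansive : forall x y, a < x < b -> a < y < b -> x <= y ->
  y - x <= S y - S x.
Hypothesis S_continuous : forall x, a < x < b -> {for x, continuous S}.

Let E y : set R := [set x | x = a \/ a < x < b /\ S x <= y].

(** The point [a] is put in the set so that the supremum is taken over a
    nonempty set even when [y] is below all the values of [S]. *)
Definition geninv y := sup (E y).

Let E_a y : E y a. Proof. by left. Qed.

Let E_ub y : ubound (E y) b.
Proof. by move=> x [->//|[/andP[_ /ltW]]]. Qed.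

Let E_sup y : has_sup (E y).
Proof. by split; [exists a|exists b]. Qed.

Let S_lt x y : a < x < b -> a < y < b -> x < y -> S x < S y.
Proof. by move=> Ix Iy xy; have := S_expansive Ix Iy (ltW xy); lra. Qed.

Let geninv_ub y x : E y x -> x <= geninv y.
Proof. by move=> Eyx; exact: sup_upper_bound. Qed.

Lemma geninv_bounds y : a <= geninv y <= b.
Proof. by rewrite geninv_ub//= ge_sup//; exists a. Qed.

Lemma geninv_homo : {homo geninv : x y / x <= y}.
Proof.
move=> y y' yy'; apply: ge_sup; first by exists a.
move=> x Ex; apply: geninv_ub; case: Ex => [->|[Ix Sx]]; [by left|right].
by split => //; exact: le_trans yy'.
Qed.

Lemma geninv_measurable :
  measurable_fun [set: measurableTypeR R]
    (geninv : measurableTypeR R -> measurableTypeR R).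
Proof. by apply: nondecreasing_measurable => //; exact: geninv_homo. Qed.

(** Together with [geninv_le], this Galois-type equivalence determines [geninv]
    and gives the preimages of segments.  Both need the continuity of [S]: a
    jump of [S] at [c] would be collapsed to [c]. *)
Lemma le_geninv c y : a < c < b -> (c <= geninv y) = (S c <= y).
Proof.
move=> Ic; apply/idP/idP => [cT|Scy]; last by apply: geninv_ub; right.
rewrite leNgt; apply/negP => ySc.
have [c' c'c [Ic' ySc']] : exists2 c', c' < c & a < c' < b /\ y < S c'.
  have Sc : \forall z \near c, y < S z.
    exact: cvgr_gt (S_continuous Ic) _ ySc.
  have Iz : \forall z \near c, a < z < b.
    have /near_in_itvoo : c \in `]a, b[ by rewrite in_itv.
    by apply: filterS => z; rewrite in_itv.
  have /nbhs_ballP[e/= e0 He] :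
      nbhs c [set z | y < S z /\ a < z < b] by exact: filterI Sc Iz.
  exists (c - e / 2); first by lra.
  have [|ySc' Ic'] := He (c - e / 2); last by [].
  by rewrite /ball/= ger0_norm; lra.
suff : geninv y <= c' by move=> /(le_trans cT); lra.
apply: ge_sup; first by exists a.
move=> x [->|[Ix Sx]]; first by case/andP: Ic' => /ltW.
by rewrite leNgt; apply/negP => /(S_lt Ic' Ix); lra.
Qed.

Lemma geninv_le y d : a < d < b -> (geninv y <= d) = (y <= S d).
Proof.
move=> Id; apply/idP/idP => [Td|ySd].
  rewrite leNgt; apply/negP => Sdy.
  have Sd : \forall z \near d, S z < y.
    exact: cvgr_lt (S_continuous Id) _ Sdy.
  have Iz : \forall z \near d, a < z < b.
    have /near_in_itvoo : d \in `]a, b[ by rewrite in_itv.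
    by apply: filterS => z; rewrite in_itv.
  have /nbhs_ballP[e/= e0 He] :
      nbhs d [set z | S z < y /\ a < z < b] by exact: filterI Sd Iz.
  have [|/ltW Sd' Id'] := He (d + e / 2);
    first by rewrite /ball/= ler0_norm; lra.
  by move: Sd'; rewrite -le_geninv// => /le_trans/(_ Td); lra.
apply: ge_sup; first by exists a.
move=> x [->|[Ix Sx]]; first by case/andP: Id => /ltW.
by rewrite leNgt; apply/negP => /(S_lt Id Ix); lra.
Qed.

Lemma geninvK x : a < x < b -> geninv (S x) = x.
Proof. by move=> Ix; apply/le_anti; rewrite geninv_le// le_geninv// !lexx. Qed.

Lemma geninv_in y : a < geninv y < b -> S (geninv y) = y.
Proof.
by move=> Ix; apply/le_anti; rewrite -geninv_le// -le_geninv// !lexx.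
Qed.

(** If [x'] with [S x' <= y'] exceeded [geninv y] by more than [y' - y], then
    [x' - (y' - y)] would be beyond [geninv y], hence mapped above [y], and
    expansion would put [S x'] above [y']. *)
Lemma geninv_contractive y y' : y <= y' -> geninv y' - geninv y <= y' - y.
Proof.
move=> yy'; rewrite lerBlDr; apply: ge_sup; first by exists a.
have /andP[aT _] := geninv_bounds y.
move=> x' [->|[Ix' Sx']]; first by lra.
rewrite leNgt; apply/negP => Tx'.
have Ix : a < x' - (y' - y) < b by lra.
have := S_expansive Ix Ix'; have := le_geninv y Ix.
case: leP; first by lra.
by move=> _ /esym/negbT; rewrite -ltNge; lra.
Qed.

Lemma geninv_lipschitz D : (1 : R).-lipschitz_D geninv.
Proof.
move=> [x y] _ /=; rewrite mul1r.
wlog xy : x y / x <= y => [H|].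
  by have [/H//|/ltW/H] := leP x y; rewrite distrC (distrC y).
rewrite distrC (distrC x) !ger0_norm ?subr_ge0// ?geninv_homo//.
exact: geninv_contractive.
Qed.

End generalized_inverse.

(** * Equality of measures on an open interval *)

Section measures_on_an_interval.
Context {R : realType}.
Notation mT := (measurableTypeR R).

Lemma eq_measure_segment (m1 m2 : {measure set mT -> \bar R}) (c d : R) :
  (m1 `[c, d]%classic < +oo)%E ->
  (forall x y, c <= x -> x <= y -> y <= d ->
    m1 `[x, y]%classic = m2 `[x, y]%classic) ->
  forall B, measurable B -> m1 (B `&` `[c, d]) = m2 (B `&` `[c, d]).
Proof.
move=> m1oo m12 B mB; have mK : measurable (`[c, d]%classic : set mT) by [].
apply: (@measure_unique _ R mT (@RGenCInfty.G R)
  (fun n => `[- n%:R, +oo[%classic) _ _ _ _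
  (mrestr m1 mK) (mrestr m2 mK)) => //.
- exact: RGenCInfty.measurableE.
- move=> _ _ [x ->] [y ->]; exists (Num.max x y).
  by apply/seteqP; split => z /=; rewrite !in_itv/= !andbT ge_max => /andP.
- by move=> n; eexists.
- apply/seteqP; split => // z _; exists (Num.bound `|z|) => //=.
  rewrite in_itv/= andbT lerNl (le_trans (ler_norm _))// normrN.
  exact/ltW/archi_boundP.
- move=> _ [x ->].
  change (m1 (`[x, +oo[ `&` `[c, d]) = m2 (`[x, +oo[ `&` `[c, d])).
  rewrite [_ `&` _](_ : _ = `[Num.max x c, d]%classic); last first.
    apply/seteqP; split => z /=; rewrite !in_itv/= andbT ge_max.
      by move=> [-> ->].
    by move=> /andP[/andP[-> ->] ->].
  have [xd|dx] := leP (Num.max x c) d; first by rewrite m12// le_max lexx orbT.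
  by rewrite set_itv_ge ?measure0// bnd_simp -ltNge.
- move=> n; apply: le_lt_trans m1oo.
  by apply: le_measure; rewrite ?inE//; exact: measurableI.
Qed.

(** Both measures may be infinite on [`]a, b[], so uniqueness on a pi-system is
    applied on each segment of an exhaustion. *)
Lemma eq_measure_itvoo (m1 m2 : {measure set mT -> \bar R}) (a b : R) :
  (forall c d, a < c -> c <= d -> d < b ->
    (m1 `[c, d]%classic < +oo)%E /\ m1 `[c, d]%classic = m2 `[c, d]%classic) ->
  forall B, measurable B -> B `<=` `]a, b[ -> m1 B = m2 B.
Proof.
move=> m12 B mB Bab; have mI : measurable (`]a, b[%classic : set mT) by [].
pose K n := `[a + n.+1%:R^-1, b - n.+1%:R^-1]%classic : set mT.
(* The complement of the interval completes the exhaustion to a cover of the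
   line; both restricted measures vanish there. *)
pose g n : set mT := if n is k.+1 then K k else ~` `]a, b[%classic.
have mg n : measurable (g n).
  by case: n => [|n]; [exact: measurableC|exact: measurable_itv].
suff : mrestr m1 mI B = mrestr m2 mI B by rewrite /mrestr setIidl.
apply: (@g_sigma_algebra_measure_unique_cover _ _ _ measurable _ g) => //.
- apply/seteqP; split => // x _.
  have [|xI] := boolP (x \in `]a, b[); last first.
    by exists 0%N => //=; exact/negP.
  rewrite in_itv/= => /andP[ax xb].
  have d0 : 0 < Num.min (x - a) (b - x) by rewrite lt_min !subr_gt0 ax.
  have [n n0] := ltr_add_invr d0.
  exists n.+1 => //; change (x \in `[a + n.+1%:R^-1, b - n.+1%:R^-1]).
  by move: n0; rewrite add0r lt_min in_itv/=; move: n.+1%:R^-1 => e; lra.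
- move=> n A mA.
  change (m1 (g n `&` A `&` `]a, b[) = m2 (g n `&` A `&` `]a, b[)).
  case: n => [|n] /=.
    by rewrite setIC setIA setICr set0I !measure0.
  have mA' : measurable A.
    by move: mA; rewrite (sigma_algebra_id (sigma_algebra_measurable _)).
  have e0 : 0 < n.+1%:R^-1 :> R by rewrite invr_gt0.
  rewrite /K; move: n.+1%:R^-1 e0 => e e0.
  have [lt|le] := leP (a + e) (b - e); last first.
    by rewrite set_itv_ge ?set0I ?measure0// bnd_simp -ltNge.
  rewrite (setIC _ A) -setIA (@setIidl _ `[a + e, b - e]%classic); last first.
    by apply: subset_itv; rewrite bnd_simp ?ltrDl ?gtrBl.
  apply: eq_measure_segment => //.
    by have [] := m12 (a + e) (b - e); rewrite ?ltrDl ?gtrBl.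
  by move=> x y ax xy yb; have [||| _ ->] := m12 x y => //; lra.
- exact: sub_sigma_algebra.
Qed.

(** [density_measure] is a bare set function; this gives access to the theory of
    measures for it. *)
Lemma density_measure_exists (D : set mT) (f : R -> R) : measurable D ->
  measurable_fun D f -> (forall x, D x -> 0 <= f x) ->
  exists m : {measure set mT -> \bar R},
    m = density_measure D f :> (set mT -> \bar R).
Proof.
move=> mD mf f0.
have f0E B x : (D `&` B) x -> (0 <= (f x)%:E)%E.
  by case=> Dx _; rewrite lee_fin f0.
have d0 : density_measure D f set0 = 0%E.
  by rewrite /density_measure setI0 integral_set0.
have d_ge0 B : (0 <= density_measure D f B)%E.
  by apply: integral_ge0 => x; exact: f0E.
have d_add : semi_sigma_additive (density_measure D f).
  move=> B mB tB mUB; rewrite /density_measure setI_bigcupr.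
  rewrite ge0_integral_bigcup//.
  - by apply: is_cvg_nneseries => n _ _; exact: d_ge0.
  - by move=> n; exact: measurableI.
  - apply/measurable_EFinP; apply: measurable_funS mf => //.
    by apply: bigcup_sub => n _; exact: subIsetl.
  - by move=> x [n _]; exact: f0E.
  - exact: trivIset_setIl.
pose M := isMeasure.Build _ _ _ (density_measure D f) d0 d_ge0 d_add.
by exists (HB.pack_for {measure set mT -> \bar R} (density_measure D f) M).
Qed.

End measures_on_an_interval.
(** * Change of variables for the generalized inverse *)

Section transport_of_densities.
Context {R : realType}.
Notation mT := (measurableTypeR R).
Variables (a b : R) (J : set R) (f g S s : R -> R).
Notation I := (`]a, b[%classic : set R).
Hypotheses (ab : a <= b) (J_itv : is_interval J).
Hypothesis f_continuous : forall x, I x -> {for x, continuous f}.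
Hypothesis g_continuous : forall y, J y -> {for y, continuous g}.
Hypothesis f_ge0 : forall x, I x -> 0 <= f x.
Hypothesis g_ge0 : forall y, J y -> 0 <= g y.
Hypothesis S_in : forall x, I x -> J (S x).
Hypothesis S_derive : forall x, I x -> is_derive x 1 S (s x).
Hypothesis s_continuous : forall x, I x -> {for x, continuous s}.
Hypothesis S_expansive : forall x y, a < x < b -> a < y < b -> x <= y ->
  y - x <= S y - S x.
Hypothesis fE : forall x, I x -> f x = g (S x) * s x.

Let S_continuous x : a < x < b -> {for x, continuous S}.
Proof.
by move=> Ix; apply: is_derive_continuous (S_derive _); rewrite /= in_itv.
Qed.

Let T := geninv a b S.

Let continuous_measurable (D : set mT) (h : R -> R) : measurable D ->
  (forall x, D x -> {for x, continuous h}) -> measurable_fun D h.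
Proof.
move=> mD ch; apply: subspace_continuous_measurable_fun => //.
by apply: continuous_in_subspaceT => x; rewrite inE => /ch.
Qed.

Let integral_segment c d : a < c -> c <= d -> d < b ->
  (\int[lebesgue_measure]_(x in `[c, d]) (f x)%:E =
   \int[lebesgue_measure]_(y in `[S c, S d]) (g y)%:E)%E.
Proof.
move=> ac cd db.
have sub x : c <= x <= d -> I x.
  move=> /andP[cx xd] /=; rewrite in_itv/=.
  by rewrite (lt_le_trans ac)// (le_lt_trans xd).
have Ic : I c by apply: sub; rewrite lexx.
have Id : I d by apply: sub; rewrite lexx cd.
have S'E x : I x -> (S^`())%classic x = s x.
  by move=> Ix; have dS := S_derive Ix; rewrite derive1E derive_val.
have cS' x : I x -> {for x, continuous (S^`())%classic}.
  move=> Ix; rewrite /prop_for /continuous_at S'E//.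
  apply: cvg_trans (s_continuous Ix); apply: near_eq_cvg.
  have /near_in_itvoo : x \in `]a, b[ by [].
  by apply: filterS => y Iy; rewrite S'E.
rewrite integration_by_substitution_increasing//.
- apply: eq_integral => x; rewrite inE/= in_itv/= => /sub Ix.
  congr EFin; change (f x = g (S x) * (S^`())%classic x).
  by rewrite fE// S'E.
- move=> x y; rewrite !in_itv/= => /sub Ix /sub Iy xy.
  rewrite -subr_gt0; apply: lt_le_trans (S_expansive _ _ (ltW xy)).
  - by rewrite subr_gt0.
  - by move: Ix; rewrite /= in_itv.
  - by move: Iy; rewrite /= in_itv.
- by move=> x; rewrite in_itv/= => /andP[cx xd]; apply/cS'/sub; rewrite !ltW.
- apply/cvg_ex; exists ((S^`())%classic c).
  by apply: cvg_at_right_filter; exact: cS'.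
- apply/cvg_ex; exists ((S^`())%classic d).
  by apply: cvg_at_left_filter; exact: cS'.
- split.
  + move=> x; rewrite in_itv/= => /andP[cx xd].
    by have [] := S_derive (sub x _); rewrite ?ltW.
  + apply: cvg_at_right_filter; apply: S_continuous.
    by move: Ic; rewrite /= in_itv.
  + apply: cvg_at_left_filter; apply: S_continuous.
    by move: Id; rewrite /= in_itv.
- apply: continuous_in_subspaceT => y; rewrite inE/= in_itv/= => yS.
  by apply: g_continuous; apply: J_itv yS; exact: S_in.
Qed.

(** The relation [f = (g \o S) * S'] says that [S] carries [f dx] to [g dx];
    nothing is claimed at [a] and [b], where the image measure may have atoms
    coming from the part of [J] outside the image of [S]. *)
Lemma geninv_image_on :
  image_on I (density_measure I f) (pushforward (density_measure J g) T).
Proof.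
have mI : measurable (I : set mT) by [].
have mJ : measurable (J : set mT) by exact: is_interval_measurable.
have [m1 m1E] :=
  density_measure_exists mI (continuous_measurable mI f_continuous) f_ge0.
have [m2 m2E] :=
  density_measure_exists mJ (continuous_measurable mJ g_continuous) g_ge0.
have measT : measurable_fun [set: mT] (T : mT -> mT).
  exact: geninv_measurable.
have [m3 m3E] : exists m3 : {measure set mT -> \bar R},
    m3 = pushforward m2 (T : mT -> mT) :> (set mT -> \bar R).
  by unshelve eexists (pushforward m2 (T : mT -> mT)).
move=> B mB BI; rewrite -m1E -m2E -[RHS](congr1 (@^~ B) m3E).
apply: (@eq_measure_itvoo _ m1 m3 a b) => // c d ac cd db.
have Ic : a < c < b by rewrite ac (le_lt_trans cd).
have Id : a < d < b by rewrite db (lt_le_trans ac).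
have m1cd : m1 `[c, d]%classic =
    (\int[lebesgue_measure]_(x in `[c, d]) (f x)%:E)%E.
  rewrite m1E /density_measure setIidr//.
  by apply: subset_itv; rewrite bnd_simp.
have int_f : lebesgue_measure.-integrable `[c, d] (EFin \o f).
  by apply: (continuous_itv_integrable (I := I)) => //=;
    [exact: interval_is_interval|rewrite in_itv..].
split.
  by rewrite m1cd ltey_eq (integrable_fin_num _ int_f).
rewrite m1cd m3E /pushforward m2E /density_measure integral_segment//.
congr (integral _ _ _); apply/seteqP; split => y /=.
  rewrite in_itv/= => /andP[Scy ySd]; split.
    apply: J_itv (_ : S c <= y <= S d); last by rewrite Scy.
      by apply: S_in; rewrite /= in_itv.
    by apply: S_in; rewrite /= in_itv.
  by rewrite in_itv/= /T le_geninv// geninv_le// Scy.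
by move=> [_]; rewrite !in_itv/= /T le_geninv// geninv_le//.
Qed.
End transport_of_densities.

(** * Symmetric intervals *)

Section symmetric_intervals.
Context {R : realType}.

Lemma symmetric_open_interval (I : set R) : open I -> is_interval I -> I 0 ->
  (forall x, I x -> I (- x)) -> has_ubound I ->
  I = `](- sup I), (sup I)[%classic.
Proof.
move=> oI Iitv I0 Isym Iub; have lt_sup x : I x -> x < sup I.
  by move=> /(open_gt oI)[y Iy xy]; apply: lt_le_trans xy _; exact: ub_le_sup.
apply/seteqP; split => x /=; rewrite in_itv/=.
  by move=> Ix; rewrite ltrNl !lt_sup//; exact: Isym.
move=> /andP[ax xa]; have d0 : 0 < sup I - `|x|.
  by rewrite subr_gt0 ltr_norml ax xa.
have [y Iy] : exists2 y, I y & sup I - (sup I - `|x|) < y.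
  by apply: sup_adherent => //; split => //; exists 0.
rewrite opprB addrC subrK ltr_norml => /andP[yx xy].
by apply: Iitv (Isym _ Iy) Iy _ _; rewrite !ltW.
Qed.

(** By the intermediate value theorem from 0, a value of [S] above [|y|] would
    make [S] take the value [|y|], hence also [y] by oddness. *)
Lemma odd_omitted_value_bound (I : set R) (S : R -> R) y : is_interval I ->
  I 0 -> (forall x, I x -> I (- x)) ->
  (forall x, I x -> {for x, continuous S}) -> (forall x, S (- x) = - S x) ->
  ~ (exists2 x, I x & S x = y) -> forall x, I x -> `|S x| <= `|y|.
Proof.
move=> Iitv I0 Isym S_cont S_odd Sy.
have S0 : S 0 = 0 by have := S_odd 0; rewrite oppr0; lra.
have hits c : I c -> S c = `|y| -> False.
  move=> Ic Sc; apply: Sy; have [y0|y0] := leP 0 y.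
    by exists c; rewrite // Sc ger0_norm.
  by exists (- c); [exact: Isym|rewrite S_odd Sc ltr0_norm// opprK].
have S_le x : I x -> S x <= `|y|.
  move=> Ix; rewrite leNgt; apply/negP => ySx.
  have S_cont_itv p q : I p -> I q -> {within `[p, q], continuous S}.
    move=> Ip Iq; apply: continuous_in_subspaceT => z.
    by rewrite inE/= in_itv/= => zpq; apply: S_cont; exact: Iitv zpq.
  have y_mid : 0 <= `|y| <= S x by rewrite normr_ge0 ltW.
  have [x0|/ltW x0] := leP 0 x.
    have [|c] := IVT x0 (S_cont_itv 0 x I0 Ix) (v := `|y|).
      by rewrite S0 ge_min le_max; case/andP: y_mid => -> ->; rewrite orbT.
    by rewrite in_itv/= => cx; apply: hits; exact: Iitv cx.
  have [|c] := IVT x0 (S_cont_itv x 0 Ix I0) (v := `|y|).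
    by rewrite S0 ge_min le_max; case/andP: y_mid => -> ->; rewrite orbT.
  by rewrite in_itv/= => cx; apply: hits; exact: Iitv cx.
move=> x Ix; rewrite ler_norml S_le// andbT lerNl -S_odd.
by apply: S_le; exact: Isym.
Qed.

End symmetric_intervals.

(** * The transport map *)

Theorem proposition6p13 (R : realType) (A : R) (I : set R) (W : R -> R)
    (A_gt0 : 0 < A)
    (I_open : open I) (I_itv : is_interval I) (I_neq0 : I !=set0)
    (I_sym : forall x, I x -> I (- x))
    (W_even : forall x, I x -> W (- x) = W x)
    (W_convex : convex_function I W)
    (W_diff : twice_derivable_on I W)
    (W_hyp : forall x, I x -> A ^+ 2 <= (W^`(2))%classic x * expR (- 2 * W x))
    (W0 : W 0 = 0) :
  let mu := density_measure I (expR \o W) in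
  exists T : measurableTypeR R -> measurableTypeR R,
    [/\ (1 : R).-lipschitz_(nu_itv A) (T : R -> R),
        {in nu_itv A &, {homo T : x y / x <= y}},
        image_on I mu (pushforward (nu_measure A) T)
      & mu I = +oo%E ->
        [/\ set_fun (nu_itv A) I T,
            {in nu_itv A &, {homo T : x y / x < y}}
          & image_on setT mu (pushforward (nu_measure A) T)]].
Proof.
move=> mu.
have I0 : I 0.
  case: I_neq0 => x Ix; have [x0|/ltW x0] := leP 0 x.
    by apply: I_itv (I_sym _ Ix) Ix _ _; rewrite x0 oppr_le0 x0.
  by apply: I_itv Ix (I_sym _ Ix) _ _; rewrite x0 oppr_ge0 x0.
have [F [F_odd dF]] :=
  odd_antiderivative_exp I_open I_itv I0 I_sym W_even W_diff.
pose S := expanding_map A F.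
have S_odd : forall x, S (- x) = - S x := expanding_map_odd A F_odd.
have S0 : S 0 = 0 by have := S_odd 0; rewrite oppr0; lra.
have S_exp := expanding_map_expansive A_gt0 I_open I_itv I0 W_even W_diff W_hyp
  W0 F_odd dF.
have S_J x : nu_itv A (S x) := expanding_map_bound A_gt0 F x.
have dS := expanding_map_derive A_gt0 dF.
have S_cont' x : I x -> {for x, continuous S}.
  by move=> Ix; exact: is_derive_continuous (dS x Ix).
(* The map is expanding and bounded, so its domain is bounded. *)
have Iub : has_ubound I.
  exists (Num.max 0 (pi / (2 * A))) => x Ix; rewrite le_max.
  have [//|/ltW x0] := leP x 0.
  have := S_exp _ _ I0 Ix x0; rewrite -/S S0 !subr0 => /le_trans -> //.
  by have := S_J x; rewrite /nu_itv/= in_itv/= => /andP[_ /ltW].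
have IE := symmetric_open_interval I_open I_itv I0 I_sym Iub.
move: (sup I) IE => a IE.
have II x : I x <-> - a < x < a by rewrite IE /= in_itv.
have aa : - a <= a by have /II := I0; lra.
have S_exp' x y : - a < x < a -> - a < y < a -> x <= y -> y - x <= S y - S x.
  by move=> /II Ix /II Iy; exact: S_exp.
have S_cont x : - a < x < a -> {for x, continuous S}.
  by move=> /II /S_cont'.
have J_cos y : nu_itv A y -> 0 < cos (A * y).
  rewrite /nu_itv/= in_itv/= => yA; apply: cos_gt0_pihalf.
  move: yA; rewrite invfM mulrA -mulNr ltr_pdivrMr// ltr_pdivlMr//.
  by rewrite (mulrC y).
have J_itv : is_interval (nu_itv A) by exact: interval_is_interval.
have J_cont y : nu_itv A y -> {for y, continuous (fun y => (cos (A * y))^-1)}.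
  move=> Jy; apply: cvgV; first by rewrite gt_eqF// J_cos.
  apply: (@continuous_comp _ _ _ ( *%R A) cos); first exact: mulrl_continuous.
  exact: continuous_cos.
pose T := geninv (- a) a S.
have im : image_on I mu (pushforward (nu_measure A) T).
  rewrite /mu IE; apply: geninv_image_on => //.
  - by rewrite -IE => x; exact: exp_potential_continuous.
  - by move=> x _; exact: expR_ge0.
  - by move=> y Jy; rewrite invr_ge0 ltW// J_cos.
  - by rewrite -IE; exact: dS.
  - by rewrite -IE => x; exact: expanding_map_derive_continuous.
  - move=> x _; rewrite /= cos_expanding_map// invrK mulrC divfK// gt_eqF//.
    exact: cosh_gt0.
exists T; split.
- exact: geninv_lipschitz.
- by move=> x y _ _; exact: geninv_homo.
- exact: im.
move=> mu_oo.
have S_onto y : nu_itv A y -> exists2 x, I x & S x = y.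
  move=> Jy; apply: contrapT => Sy.
  have S_le := odd_omitted_value_bound I_itv I0 I_sym S_cont' S_odd Sy.
  have Jy' : nu_itv A `|y|.
    have [y0|y0] := leP 0 y; first by rewrite ger0_norm.
    rewrite ltr0_norm//; move: Jy; rewrite /nu_itv/= !in_itv/=.
    by move=> /andP[y1 y2]; lra.
  have JNy' : nu_itv A (- `|y|).
    by move: Jy'; rewrite /nu_itv/= !in_itv/=; lra.
  (* The mass of [mu] is that of the part of [nu_itv A] sent into [I], that is
     of the image of [S]. *)
  have := mu_oo; rewrite im//; last exact: is_interval_measurable.
  have int_sec := continuous_itv_integrable J_itv J_cont JNy' Jy'.
  apply/eqP; rewrite -ltey.
  have mK : measurable (`[- `|y|, `|y|]%classic : set (measurableTypeR R)).
    by [].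
  have := integrable_fin_num mK int_sec.
  rewrite fin_numElt => /andP[_]; apply: le_lt_trans.
  rewrite /pushforward /nu_measure /density_measure.
  apply: ge0_subset_integral => //.
  - apply: measurableI; first exact: is_interval_measurable.
    rewrite -[_ @^-1` _]setTI; apply: (geninv_measurable S aa) => //.
    exact: is_interval_measurable.
  - by case/integrableP: int_sec.
  - move=> z; rewrite /= in_itv/= => zy.
    rewrite lee_fin invr_ge0 ltW// J_cos//; exact: J_itv JNy' Jy' _ zy.
  - move=> z [_ /II Tz] /=; rewrite in_itv/= -ler_norml.
    have := geninv_in aa S_exp' S_cont Tz => Sz.
    by rewrite -Sz; apply: S_le; exact/II.
split.
- by move=> y /S_onto[x /II Ix <-]; rewrite /T geninvK//; exact/II.
- move=> y z; rewrite !inE => /S_onto[x /II Ix <-] /S_onto[x' /II Ix' <-] xx'.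
  rewrite /T !geninvK// ltNge; apply/negP => x'x.
  by have := S_exp' _ _ Ix' Ix x'x; lra.
- move=> B mB _; transitivity (mu (I `&` B)).
    by rewrite /mu /density_measure setIA setIid.
  rewrite im; last by apply: subIsetl.
    rewrite /pushforward /nu_measure /density_measure; congr (integral _ _ _).
    apply/seteqP; split => y /= [Jy]; first by case.
    move=> By; do 2!split => //; have [x /II Ix <-] := S_onto _ Jy.
    by rewrite /T geninvK//; exact/II.
  by apply: measurableI => //; exact: is_interval_measurable.
Qed.
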